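(* Let $\phi$ be a frequency charge on $\mathbb{N}=\{1,2,\ldots\}$. Let $E_0=\{1,3,5,\ldots\}$ and, for each $n\in\mathbb{N}$, let $E_n=\{k\cdot 2^n : k\in\mathbb{N}\}$. Define diffuse charges on $\mathbb{N}$ by $\mu_0(W)=2\,\phi(W\cap E_0)$ and, for each $n\in\mathbb{N}$, $\mu_n(W)=2^n\,\phi(W\cap E_n)$, for all $W\subseteq\mathbb{N}$. Let $\mu_*$ be an accumulation point of the sequence $\{\mu_n\}_{n=1}^\infty$ in the set of charges on $\mathbb{N}$ endowed with the topology of pointwise convergence, and let $\mu=\tfrac12\mu_0+\tfrac12\mu_*$ (a diffuse charge). Then in the even-or-odd Markov decision process with aggregation charge $\mu$, the decision maker has no optimal strategy, neither pure nor randomized; that is, there is no strategy $\sigma\in\Sigma$ with $u_\mu(\sigma)=v_\mu$, where $v_\mu=\sup_{\sigma'\in\Sigma}u_\mu(\sigma')$.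
   Context: The axioms of ZFC are assumed. **Charges.** A charge on $\mathbb{N}=\{1,2,\ldots\}$ is a map $\mu:2^{\mathbb{N}}\to[0,1]$ with $\mu(\emptyset)=0$, $\mu(\mathbb{N})=1$ and $\mu(M_1\cup M_2)=\mu(M_1)+\mu(M_2)$ for all disjoint $M_1,M_2\subseteq\mathbb{N}$. Let $\Delta^f$ be the set of all charges on $\mathbb{N}$. A charge $\mu$ is diffuse if $\mu(\{n\})=0$ for every $n\in\mathbb{N}$. A diffuse charge $\phi$ is a frequency charge if $\phi(M)=\lim_{n\to\infty}\frac{|\{1,\ldots,n\}\cap M|}{n}$ for each $M\subseteq\mathbb{N}$ for which this limit exists. (Frequency charges exist.) **Integration.** For a simple function $s=\sum_{i=1}^m c_i\mathbb{I}_{M_i}$, with $c_i\in\mathbb{R}$ and $\{M_1,\ldots,M_m\}$ a partition of $\mathbb{N}$, set $\int_{t\in\mathbb{N}} s(t)\,\mu(dt)=\sum_{i=1}^m c_i\,\mu(M_i)$. For a bounded $f:\mathbb{N}\to\mathbb{R}$, $\int_{t\in\mathbb{N}} f(t)\,\mu(dt)$ is the supremum of $\int s\,d\mu$ over simple functions $s\le f$ (equivalently, the infimum over simple functions $s\ge f$). **Topology.** The topology of pointwise convergence on $\Delta^f$ is the smallest topology making $\mu\mapsto\mu(M)$ continuous for each $M\subseteq\mathbb{N}$; $\Delta^f$ is compact and Hausdorff under it. A charge $\mu\in\Delta^f$ is an accumulation point of a sequence $\{\mu_n\}_{n\in\mathbb{N}}$ in $\Delta^f$ if for every finite collection $\{M_1,\ldots,M_k\}$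 of subsets of $\mathbb{N}$ and every $\epsilon>0$ there is a sequence $m_1<m_2<\cdots$ such that $|\mu(M_i)-\mu_{m_n}(M_i)|\le\epsilon$ for all $n\in\mathbb{N}$ and all $i=1,\ldots,k$ (equivalently, some subnet of the sequence converges to $\mu$). By compactness, every sequence in $\Delta^f$ has an accumulation point. **Markov decision processes (MDPs).** An MDP consists of a nonempty finite state space $S$ with an initial state $s^*\in S$, a nonempty finite action set $A(s)$ for each $s\in S$, a reward $r(s,a)\in\mathbb{R}$ and a probability measure $p(\cdot|s,a)$ on $S$ for each $s\in S$, $a\in A(s)$. It is played at stages $t\in\mathbb{N}$: $s_1=s^*$; at stage $t$ in state $s_t$ the decision maker chooses $a_t\in A(s_t)$, receives reward $r_t=r(s_t,a_t)$, and $s_{t+1}$ is drawn according to $p(\cdot|s_t,a_t)$. A history at stage $t$ is a sequence $(s_1=s^*,a_1,\ldots,s_{t-1},a_{t-1},s_t)$ with $s_i\in S$ and $a_i\in A(s_i)$. A strategy $\sigma$ assigns to each history $h$ ending in a state $s_t$ a probability measure $\sigma(h)$ on $A(s_t)$; $\Sigma$ is the set of all strategies. A strategy is pure if every $\sigma(h)$ puts probability one on a single action, and randomized otherwise. Let $\mathbb{E}_\sigma$ denote expectation under $\sigma$. **Payoff, value, optimality.** Given a diffuse charge $\mu$ (the aggregation charge), the payoff of $\sigma$ is $u_\mu(\sigma)=\int_{t\in\mathbb{N}}\mathbb{E}_\sigma[r_t]\,\mu(dt)$, the value is $v_\mu=\sup_{\sigma\in\Sigma}u_\mu(\sigma)$,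 and $\sigma$ is optimal if $u_\mu(\sigma)=v_\mu$. **The even-or-odd MDP.** The state space is $S=\{1,2,3\}$ with initial state $1$. In state 1 there are two actions $T$ and $B$; in states 2 and 3 there is only one action. In state 1 the reward is $1$ for action $T$ and $0$ for action $B$; in state 2 the reward is $0$; in state 3 the reward is $1$. Transitions are deterministic: action $T$ in state 1 leads to state 2, action $B$ in state 1 leads to state 3, and from states 2 and 3 the play moves to state 1. *)

(* Defs.v *)
From HB Require Import structures.
From mathcomp Require Import all_boot all_order all_algebra finmap.
From mathcomp Require Import boolp classical_sets functions cardinality.
From mathcomp Require Import reals topology normedtype sequences.

Set Implicit Arguments.
Unset Strict Implicit.
Unset Printing Implicit Defensive.

Import Order.TTheory GRing.Theory Num.Theory.
Import numFieldNormedType.Exports.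

Local Open Scope classical_set_scope.
Local Open Scope ring_scope.

(* Here N = {1, 2, ...}, without 0. *)
Definition posn := {n : nat | (0 < n)%N}.

Section Charges.
Variable R : realType.

(* Finitely additive probabilities on all subsets of {1, 2, ...}; these are
   not the countably additive signed charges of mathcomp.analysis.charge. *)
Record fcharge := FCharge {
  fcharge_fun :> set posn -> R;
  fcharge_itv : forall M, 0 <= fcharge_fun M <= 1;
  fcharge_set0 : fcharge_fun set0 = 0;
  fcharge_setT : fcharge_fun setT = 1;
  fcharge_setU : forall M1 M2, M1 `&` M2 = set0 ->
    fcharge_fun (M1 `|` M2) = fcharge_fun M1 + fcharge_fun M2 }.

Definition diffuse (mu : fcharge) : Prop := forall n : posn, mu [set n] = 0.

(* The number of elements of M in {1, ..., n}. *)
Definition count_upto (M : set posn) (n : nat) : nat :=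
  #|` fset_set ([set k : posn | (val k <= n)%N] `&` M)|.

Record freq_charge := FreqCharge {
  freq_fcharge :> fcharge;
  freq_diffuse : diffuse freq_fcharge;
  freq_density : forall (M : set posn) (l : R),
    (fun n : nat => (count_upto M n)%:R / n%:R : R) @ \oo --> l ->
    freq_fcharge M = l }.

(* s = \sum_i c_i 1_(M_i), with the M_i nonempty and partitioning {1, 2, ...}. *)
Record simple_fun := SimpleFun {
  sf_size : nat;
  sf_coef : 'I_sf_size -> R;
  sf_block : 'I_sf_size -> set posn;
  sf_partition : partition setT sf_block setT }.

Definition sf_eval (s : simple_fun) (t : posn) : R :=
  \sum_(i < sf_size s) sf_coef i * (t \in sf_block i)%:R.

Definition sf_integral (mu : fcharge) (s : simple_fun) : R :=
  \sum_(i < sf_size s) sf_coef i * mu (sf_block i).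

(* Meaningful for bounded f only. *)
Definition fintegral (mu : fcharge) (f : posn -> R) : R :=
  sup [set sf_integral mu s | s in [set s | forall t, sf_eval s t <= f t]].

Definition accumulation_point (mu_ : posn -> fcharge) (mu : fcharge) : Prop :=
  forall (k : nat) (M : 'I_k -> set posn) (eps : R), 0 < eps ->
  exists m : posn -> posn,
    (forall i j, (val i < val j)%N -> (val (m i) < val (m j))%N) /\
    (forall n i, `|mu (M i) - mu_ (m n) (M i)| <= eps).

End Charges.

Section SpecialCharges.
Variable R : realType.

Lemma fcharge_le (mu : fcharge R) (A B : set posn) :
  A `<=` B -> mu A <= mu B.
Proof.
move=> AB; have -> : B = A `|` (B `\` A) by rewrite setDUK.
rewrite fcharge_setU; last by rewrite setDE setICA setICr setI0.
by rewrite lerDl; case/andP: (fcharge_itv mu (B `\` A)).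
Qed.

Section Restriction.
Variables (phi : fcharge R) (c : R) (E : set posn).
Hypotheses (c0 : 0 <= c) (cE : c * phi E = 1).

Let rho (W : set posn) : R := c * phi (W `&` E).

Let rho_itv M : 0 <= rho M <= 1.
Proof.
apply/andP; split.
  by apply: mulr_ge0 => //; case/andP: (fcharge_itv phi (M `&` E)).
by rewrite -cE; apply: ler_wpM2l => //; apply: fcharge_le => x [].
Qed.

Let rho_set0 : rho set0 = 0.
Proof. by rewrite /rho set0I fcharge_set0 mulr0. Qed.

Let rho_setT : rho setT = 1.
Proof. by rewrite /rho setTI. Qed.

Let rho_setU M1 M2 : M1 `&` M2 = set0 -> rho (M1 `|` M2) = rho M1 + rho M2.
Proof.
move=> M12; rewrite /rho setIUl fcharge_setU ?mulrDr//.
by rewrite setIACA M12 set0I.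
Qed.

Definition restrict_fcharge : fcharge R :=
  FCharge rho_itv rho_set0 rho_setT rho_setU.

End Restriction.

Section Mixture.
Variables mu nu : fcharge R.

Let mix (W : set posn) : R := 2^-1 * mu W + 2^-1 * nu W.

Let mix_itv M : 0 <= mix M <= 1.
Proof.
have /andP[a0 a1] := fcharge_itv mu M; have /andP[b0 b1] := fcharge_itv nu M.
have h0 : 0 <= 2^-1 :> R by rewrite invr_ge0.
rewrite /mix addr_ge0 ?mulr_ge0//= -mulrDr mulrC ler_pdivrMr// mul1r.
by apply: (le_trans (lerD a1 b1)).
Qed.

Let mix_set0 : mix set0 = 0.
Proof. by rewrite /mix !fcharge_set0 !mulr0 addr0. Qed.

Let mix_setT : mix setT = 1.
Proof. by rewrite /mix !fcharge_setT -mulrDr mulVf ?pnatr_eq0. Qed.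

Let mix_setU M1 M2 : M1 `&` M2 = set0 -> mix (M1 `|` M2) = mix M1 + mix M2.
Proof. by move=> M12; rewrite /mix !fcharge_setU// !mulrDr addrACA. Qed.

Definition mix_fcharge : fcharge R := FCharge mix_itv mix_set0 mix_setT mix_setU.

End Mixture.

Definition odd_set : set posn := [set k | odd (val k)].

Definition mult_set (n : posn) : set posn :=
  [set x | exists k : posn, val x = (val k * 2 ^ val n)%N].

Lemma count_mult_set (n : posn) (N : nat) :
  count_upto (mult_set n) N = (N %/ 2 ^ val n)%N.
Proof.
set d := (2 ^ val n)%N; have d0 : (0 < d)%N by rewrite expn_gt0.
apply: card_fset_set.
have jP (j : nat) : (0 < j.+1 * d)%N by rewrite muln_gt0.
pose f (j : nat) : posn := exist _ (j.+1 * d)%N (jP j).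
have -> : [set k : posn | (val k <= N)%N] `&` mult_set n = f @` `I_(N %/ d).
  apply/seteqP; split => [x /= [xN [k xk]]|x /= [j jN <-]].
    have k0 : (0 < val k)%N by exact: valP k.
    exists (val k).-1; first by rewrite /= prednK// leq_divRL// -xk.
    by apply/val_inj; rewrite /= prednK.
  split; first by rewrite /= -leq_divRL.
  by exists (exist _ j.+1 isT).
apply: inj_card_eq => i j _ _ /(congr1 val) /= /eqP.
by rewrite eqn_pmul2r// eqSS => /eqP.
Qed.

Lemma cvg_divn (d : nat) : (0 < d)%N ->
  (fun n : nat => (n %/ d)%:R / n%:R : R) @ \oo --> (d%:R^-1 : R).
Proof.
move=> d0; have dR : 0 < d%:R :> R by rewrite ltr0n.
rewrite -cvg_shiftS /=.
apply: (@squeeze_cvgr _ _ _ _ (fun n => d%:R^-1 - n.+1%:R^-1) (fun=> d%:R^-1)).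
- apply: nearW => n; have nR : 0 < n.+1%:R :> R by rewrite ltr0n.
  apply/andP; split.
    rewrite ler_pdivlMr// mulrBl mulVf ?gt_eqF// lerBlDr mulrC ler_pdivrMr//.
    by rewrite -[1]/(1%:R) -natrD -natrM ler_nat addn1 ltnW// ltn_ceil.
  rewrite ler_pdivrMr// mulrC ler_pdivlMr// -natrM ler_nat.
  exact: leq_trunc_div.
- rewrite -[X in _ --> X]subr0; apply: cvgB; first exact: cvg_cst.
  exact: cvg_harmonic.
- exact: cvg_cst.
Qed.

Lemma freq_mult_set (phi : freq_charge R) (n : posn) :
  phi (mult_set n) = (2 ^+ val n)^-1.
Proof.
apply: freq_density; rewrite -natrX.
under eq_fun do rewrite count_mult_set.
by apply: cvg_divn; rewrite expn_gt0.
Qed.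

Lemma freq_mult_setM (phi : freq_charge R) (n : posn) :
  2 ^+ val n * phi (mult_set n) = 1.
Proof. by rewrite freq_mult_set divff// expf_neq0// pnatr_eq0. Qed.

Lemma freq_odd_setM (phi : freq_charge R) : 2 * phi odd_set = 1.
Proof.
have odd_multC : odd_set `|` mult_set (exist _ 1%N isT) = setT.
  apply/seteqP; split => // x _; case/boolP: (odd (val x)) => xo; [by left|right].
  have x2 : (0 < (val x)./2)%N.
    by case: x xo => -[|[|m]].
  exists (exist (fun n => (0 < n)%N) _ x2) => /=.
  by rewrite expn1 muln2 -[LHS]odd_double_half (negbTE xo).
have odd_multI : odd_set `&` mult_set (exist _ 1%N isT) = set0.
  apply/seteqP; split => // x [/= + [k xk]].
  by rewrite /odd_set /= xk expn1 muln2 odd_double.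
have := fcharge_setU phi odd_multI.
rewrite odd_multC fcharge_setT freq_mult_set /= expr1 => /(congr1 ( *%R 2)).
rewrite mulrDr mulr1 divff ?pnatr_eq0// => h.
by apply: (addIr 1); rewrite -h -natr1.
Qed.

Lemma restrict_diffuse (phi : fcharge R) (c : R) (E : set posn)
    (c0 : 0 <= c) (cE : c * phi E = 1) :
  diffuse phi -> diffuse (restrict_fcharge c0 cE).
Proof.
move=> phid n /=; apply/eqP; rewrite mulf_eq0; apply/orP; right.
have /andP[ge0 _] := fcharge_itv phi ([set n] `&` E).
by rewrite eq_le ge0 andbT -(phid n); apply: fcharge_le => x [].
Qed.

(* mu_0 (W) = 2 phi (W `&` E_0) *)
Definition mu_odd (phi : freq_charge R) : fcharge R :=
  restrict_fcharge (ler0n R 2) (freq_odd_setM phi).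

(* mu_n (W) = 2 ^ n phi (W `&` E_n), for n >= 1 *)
Definition mu_mult (phi : freq_charge R) (n : posn) : fcharge R :=
  restrict_fcharge (exprn_ge0 _ (ler0n R 2)) (freq_mult_setM phi n).

Lemma mu_odd_diffuse (phi : freq_charge R) : diffuse (mu_odd phi).
Proof. exact/restrict_diffuse/freq_diffuse. Qed.

Lemma mu_mult_diffuse (phi : freq_charge R) (n : posn) :
  diffuse (mu_mult phi n).
Proof. exact/restrict_diffuse/freq_diffuse. Qed.

End SpecialCharges.

Record fdist (R : realType) (T : finType) := FDist {
  pmf :> T -> R;
  pmf_ge0 : forall x, 0 <= pmf x;
  pmf_sum1 : \sum_x pmf x = 1 }.

Section Dirac.
Variables (R : realType) (T : finType) (a : T).

Let dirac_pmf (x : T) : R := (x == a)%:R.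

Let dirac_ge0 x : 0 <= dirac_pmf x.
Proof. exact: ler0n. Qed.

Let dirac_sum1 : \sum_x dirac_pmf x = 1.
Proof.
by rewrite (bigD1 a)//= /dirac_pmf eqxx big1 ?addr0// => i /negbTE ->.
Qed.

Definition fdirac : fdist R T := FDist dirac_ge0 dirac_sum1.

End Dirac.

Record mdp (R : realType) := MDP {
  state : finType;
  init : state;
  action : state -> finType;
  action_gt0 : forall s, (0 < #|action s|)%N;
  reward : forall s, action s -> R;
  transition : forall s, action s -> fdist R state }.

Section Payoff.
Variables (R : realType) (G : mdp R).

(* history s: the sequences (s_1, a_1, ..., s_t) with s_1 = init G, s_t = s and
   each a_i an action at s_i; hcons h a s' is the sequence (h, a, s'). *)
Inductive history : state G -> Type :=
| hinit : history (init G)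
| hcons (s : state G) (h : history s) (a : action s) (s' : state G) : history s'.

Definition strategy := forall s : state G, history s -> fdist R (action s).

(* All histories at stage t.+1. *)
Fixpoint histories (t : nat) : seq {s : state G & history s} :=
  if t is t'.+1 then
    [seq Tagged history (hcons (tagged h) au.1 au.2)
       | h <- histories t', au <- enum {: action (tag h) * state G}]
  else [:: Tagged history hinit].

(* The probability that the play under sigma starts with h. *)
Fixpoint hprob (sigma : strategy) (s : state G) (h : history s) : R :=
  match h with
  | hinit => 1
  | @hcons s0 h0 a s' => hprob sigma h0 * sigma s0 h0 a * transition a s'
  end.

(* The expectation of r_t under sigma; stages are numbered from 1. *)
Definition expected_reward (sigma : strategy) (t : posn) : R :=
  \sum_(h <- histories (val t).-1)
    \sum_(a : action (tag h))
      hprob sigma (tagged h) * sigma (tag h) (tagged h) a * reward a.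

Definition payoff (mu : fcharge R) (sigma : strategy) : R :=
  fintegral mu (expected_reward sigma).

Definition value (mu : fcharge R) : R := sup [set payoff mu sigma | sigma in setT].

Definition optimal (mu : fcharge R) (sigma : strategy) : Prop :=
  payoff mu sigma = value mu.

End Payoff.

Inductive eo_state := state1 | state2 | state3.

Definition eo_state_code (s : eo_state) : option bool :=
  match s with state1 => None | state2 => Some true | state3 => Some false end.

Definition eo_state_decode (c : option bool) : eo_state :=
  match c with None => state1 | Some true => state2 | Some false => state3 end.

Lemma eo_state_codeK : cancel eo_state_code eo_state_decode.
Proof. by case. Qed.

HB.instance Definition _ := Finite.copy eo_state (can_type eo_state_codeK).

Inductive eo_choice := actT | actB.

Definition eo_choice_code (a : eo_choice) : bool :=
  match a with actT => true | actB => false end.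

Definition eo_choice_decode (b : bool) : eo_choice := if b then actT else actB.

Lemma eo_choice_codeK : cancel eo_choice_code eo_choice_decode.
Proof. by case. Qed.

HB.instance Definition _ := Finite.copy eo_choice (can_type eo_choice_codeK).

Definition eo_action (s : eo_state) : finType :=
  match s with state1 => eo_choice | _ => unit end.

Lemma eo_action_gt0 (s : eo_state) : (0 < #|eo_action s|)%N.
Proof. by case: s; apply/card_gt0P; [exists actT|exists tt|exists tt]. Qed.

Definition eo_reward (R : realType) (s : eo_state) : eo_action s -> R :=
  match s with
  | state1 => fun a => match a with actT => 1 | actB => 0 end
  | state2 => fun=> 0
  | state3 => fun=> 1
  end.

Definition eo_next (s : eo_state) : eo_action s -> eo_state :=
  match s with
  | state1 => fun a => match a with actT => state2 | actB => state3 end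
  | state2 => fun=> state1
  | state3 => fun=> state1
  end.

Definition even_or_odd (R : realType) : mdp R :=
  MDP state1 eo_action_gt0 (@eo_reward R)
    (fun s a => fdirac R (eo_next a)).

(* Main.v *)
(* Group the stages into pairs {2k+1, 2k+2}. Under any strategy the play is in
   state 1 at stage 2k+1, and the expected rewards of the two stages sum to 1.

   A set that contains exactly one stage of each pair has density 1/2. Hence,
   although phi is only assumed to extend density, it gives the same mass to
   {2k+1 : k in A} and {2k+2 : k in A} for every A. Playing B exactly in the
   pairs with 2^n | 2k+2 thus costs at most 2^-n, since mu_star(E_n) = 1; the
   value is 1.

   If a strategy had payoff 1, let A be the set of k with expected reward at
   most 1/2 at stage 2k+1. The reward is at most 1/2 on the stages 2k+1 with
   k in A and on the stages 2k+2 with k not in A, so mu gives this set mass 0.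
   Then phi{2k+1 : k in A} = 0, so phi{2k+2 : k in A} = 0 and hence
   mu_star{2k+2 : k in A} = 0; but also mu_star{2k+2 : k not in A} = 0,
   whereas mu_star gives the even stages mass 1. *)
Require Import Defs.
From mathcomp Require Import all_boot all_order all_algebra.
From mathcomp Require Import reals.
From mathcomp Require Import finmap boolp classical_sets cardinality.
From mathcomp Require Import topology normedtype sequences.
From mathcomp Require Import lra.

Set Implicit Arguments.
Unset Strict Implicit.
Unset Printing Implicit Defensive.

Import Order.TTheory GRing.Theory Num.Theory.
Import numFieldNormedType.Exports.

Local Open Scope classical_set_scope.
Local Open Scope ring_scope.

(** * Pairs of consecutive stages, and sets with one stage from each pair *)

Section Density.
Implicit Types (M : set posn) (A : set nat).

Definition oddp (k : nat) : posn := exist _ k.*2.+1 isT.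
Definition evenp (k : nat) : posn := exist _ k.*2.+2 isT.

Lemma posnP (t : posn) : {k | t = oddp k} + {k | t = evenp k}.
Proof.
case: t => -[//|n] n0; case: (boolP (odd n)) => on; [right|left];
  exists n./2; apply/val_inj => /=;
  by rewrite -[in LHS](odd_double_half n) ?on ?(negbTE on).
Qed.

Lemma oddp_inj : injective oddp.
Proof. by move=> i j /(congr1 val) /= [] /double_inj. Qed.

Lemma evenp_inj : injective evenp.
Proof. by move=> i j /(congr1 val) /= [] /double_inj. Qed.

Lemma oddp_neq_evenp i j : oddp i <> evenp j.
Proof. by move=> /(congr1 val) /= [] /(congr1 odd) /=; rewrite !odd_double. Qed.

Lemma odd_setE : odd_set = oddp @` setT.
Proof.
apply/seteqP; split => [t|t [k _ <-]]; last by rewrite /odd_set /= odd_double.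
have [[k ->]|[k ->]] := posnP t; first by exists k.
by rewrite /odd_set /= odd_double.
Qed.

(** As n >= 1, every multiple of 2^n is even, hence the second stage of its pair. *)
Lemma mult_setE (n : posn) :
  mult_set n = evenp @` [set k | (2 ^ val n %| k.+1.*2)%N].
Proof.
case: n => -[//|n] n0; apply/seteqP; split => t.
  move=> [[[//|k] k0] /= tk]; exists (k.+1 * 2 ^ n).-1.
    rewrite /= prednK ?muln_gt0 ?expn_gt0// -muln2 -mulnA -expnSr.
    exact: dvdn_mull.
  apply/val_inj => /=; rewrite tk -doubleS prednK ?muln_gt0 ?expn_gt0//.
  by rewrite -muln2 -mulnA -expnSr.
move=> [k /= /dvdnP[[//|m] km] <-]; exists (exist _ m.+1 isT) => /=.
by rewrite -doubleS km.
Qed.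

Definition selector A : set posn := oddp @` A `|` evenp @` (~` A).

Lemma finite_initial (n : nat) : finite_set [set k : posn | (val k <= n)%N].
Proof.
apply: (@finite_preimage _ _ `I_n.+1 val); last exact: finite_II.
by move=> i j _ _ /val_inj.
Qed.

Lemma count_uptoS M (n : nat) :
  count_upto M n.+1 = (count_upto M n + (exist _ n.+1 isT \in M))%N.
Proof.
pose p : posn := exist _ n.+1 isT; rewrite /count_upto.
have fin := finite_setIl M (finite_initial n).
have initS : [set k : posn | (val k <= n.+1)%N] =
    p |` [set k : posn | (val k <= n)%N].
  apply/seteqP; split => k /=.
    by rewrite leq_eqVlt => /orP[/eqP kn|]; [left; exact/val_inj|right].
  by move=> [->//|/leqW].
rewrite initS setIUl.
have [pM|pM] := boolP (p \in M).
  have -> : [set p] `&` M = [set p].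
    by apply/seteqP; split => x [] // ->; split => //; exact: set_mem.
  have npM : p \notin [set k : posn | (val k <= n)%N] `&` M.
    by apply/negP => /set_mem[]; rewrite /= ltnn.
  by rewrite fset_setU1// cardfsU1 in_fset_set// npM addnC.
have -> : [set p] `&` M = set0.
  by apply/seteqP; split => // x [-> /mem_set]; rewrite (negbTE pM).
by rewrite set0U addn0.
Qed.

Lemma oddp_selector A k : (oddp k \in selector A) = (k \in A).
Proof.
apply/idP/idP => /set_mem h; apply/mem_set; last by left; exists k.
by case: h => [[j Aj /oddp_inj <-]|[j _ /esym /oddp_neq_evenp]].
Qed.

Lemma evenp_selector A k : (evenp k \in selector A) = (k \notin A).
Proof.
apply/idP/idP => [/set_mem h|kA]; last first.
  by apply/mem_set; right; exists k => //=; move: kA; rewrite notin_setE.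
by case: h => [[j _ /oddp_neq_evenp]//|[j Aj /evenp_inj <-]]; rewrite notin_setE.
Qed.

(** A selector and its complement will be the two blocks of a simple function, and blocks must be
    nonempty. *)
Lemma selector_neq0 A : selector A !=set0.
Proof.
have [A0|A0] := pselect (A 0); first by exists (oddp 0); left; exists 0.
by exists (evenp 0); right; exists 0.
Qed.

Lemma selectorC_neq0 A : ~` selector A !=set0.
Proof.
have [A0|A0] := boolP (0 \in A).
  by exists (evenp 0); rewrite /= -notin_setE evenp_selector A0.
by exists (oddp 0); rewrite /= -notin_setE oddp_selector.
Qed.

Lemma count_selector_double A k : count_upto (selector A) k.*2 = k.
Proof.
elim: k => [|k IHk].
  rewrite /count_upto (_ : _ `&` _ = set0) ?fset_set0 ?cardfs0//.
  by apply/seteqP; split => // -[[|m] m0] [].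
rewrite doubleS !count_uptoS IHk.
by rewrite oddp_selector evenp_selector; case: (k \in A); rewrite ?addn0 ?addn1.
Qed.

(** The first n stages are n/2 full pairs, each counted once, and at most one further stage. *)
Lemma count_selector A n :
  (n %/ 2 <= count_upto (selector A) n <= (n %/ 2).+1)%N.
Proof.
rewrite divn2 -[n in count_upto _ n](odd_double_half n).
case: (odd n); rewrite ?add0n ?add1n ?count_uptoS count_selector_double.
  by case: (_ \in _); rewrite ?addn0 ?addn1 !leqnn ?leqnSn.
by rewrite leqnn leqnSn.
Qed.

End Density.

(** * Frequency charges on odd and even stages *)

Section FrequencyCharge.
Variables (R : realType) (phi : freq_charge R).
Implicit Type A : set nat.

Lemma freq_selector A : phi (selector A) = 2^-1.
Proof.
apply: freq_density; have half := @cvg_divn R 2 isT.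
apply: (@squeeze_cvgr _ _ _ _ (fun n => (n %/ 2)%:R / n%:R)
  (fun n => (n %/ 2)%:R / n%:R + n%:R^-1)) => //.
  apply: nearW => n; have /andP[lo hi] := count_selector A n.
  (* The case n = 0 is not special, since the inverse of 0 is 0. *)
  rewrite -[X in _ + X]mul1r -mulrDl.
  by rewrite !ler_wpM2r ?invr_ge0 ?ler0n ?ler_nat// natr1 ler_nat.
rewrite -[X in _ --> X]addr0; apply: cvgD => //.
by rewrite -cvg_shiftS; exact: cvg_harmonic.
Qed.

Lemma freq_oddp_evenpC A : phi (oddp @` A) + phi (evenp @` (~` A)) = 2^-1.
Proof.
rewrite -fcharge_setU ?freq_selector//.
by apply/seteqP; split => // t [[i _ <-] [j _ /esym/oddp_neq_evenp]].
Qed.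

Lemma freq_oddpC A : phi (oddp @` A) + phi (oddp @` (~` A)) = 2^-1.
Proof.
rewrite -fcharge_setU; last first.
  by apply/seteqP; split => // t [[i Ai <-] [j Aj /oddp_inj ji]]; apply: Aj; rewrite ji.
rewrite -image_setU setUCr -odd_setE.
by apply: (mulfI (_ : 2 != 0)); rewrite ?pnatr_eq0// freq_odd_setM mulfV ?pnatr_eq0.
Qed.

(** Both masses complete that of the odd stages with index outside A to 1/2: one through a selector,
    the other through the set of all odd stages. A itself may have no density. *)
Lemma freq_evenp A : phi (evenp @` A) = phi (oddp @` A).
Proof.
have := freq_oddp_evenpC (~` A); have := freq_oddpC A; rewrite setCK; lra.
Qed.

End FrequencyCharge.

(** * Bounds on integrals against a charge *)

Section Integral.
Variables (R : realType) (mu : fcharge R).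
Implicit Types (s : simple_fun R) (f : posn -> R) (Z : set posn).

Lemma fcharge_ge0 Z : 0 <= mu Z.
Proof. by have /andP[] := fcharge_itv mu Z. Qed.

Lemma fcharge_setIC Z M : mu M = mu (M `&` Z) + mu (M `&` ~` Z).
Proof.
rewrite -fcharge_setU; last by rewrite setIACA setICr setI0.
by rewrite -setIUr setUCr setIT.
Qed.

Lemma fcharge_setC Z : mu (~` Z) = 1 - mu Z.
Proof. rewrite -(fcharge_setT mu) (fcharge_setIC Z setT) !setTI; lra. Qed.

Lemma bigsetU_ord T (n : nat) (F : 'I_n -> set T) :
  \big[setU/set0]_(i < n) F i = \bigcup_i F i.
Proof. by rewrite -(bigcup_pred predT); apply: eq_bigcupl; split. Qed.

Lemma fcharge_bigcup (n : nat) (F : 'I_n -> set posn) :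
  trivIset setT F -> mu (\bigcup_i F i) = \sum_(i < n) mu (F i).
Proof.
rewrite -bigsetU_ord; elim: n F => [|n IHn] F tF.
  by rewrite !big_ord0 fcharge_set0.
rewrite !big_ord_recl fcharge_setU ?IHn//.
  by move=> i j _ _ /tF h; exact/(@lift_inj _ ord0)/h.
rewrite bigsetU_ord setI_bigcupr bigcup0// => i _.
by apply: contrapT => /eqP/set0P/(tF _ _ I I).
Qed.

Lemma sf_eval_block s (i : 'I_(sf_size s)) t : sf_block i t -> sf_eval s t = sf_coef i.
Proof.
move=> it; rewrite /sf_eval (bigD1 i)//= mem_set// mulr1 big1 ?addr0// => j ji.
have [_ tr _] := sf_partition s.
have [/set_mem jt|] := boolP (t \in sf_block j); last by rewrite mulr0.
by move: ji; rewrite (tr j i)// ?eqxx//; exists t.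
Qed.

Lemma sf_fcharge_sum s Z : \sum_(i < sf_size s) mu (sf_block i `&` Z) = mu Z.
Proof.
have [cov tr _] := sf_partition s.
rewrite -fcharge_bigcup; first by rewrite -setI_bigcupl [X in X `&` _]cov setTI.
by move=> i j _ _ [t [[it _] [jt _]]]; apply: tr => //; exists t.
Qed.

(** Cut each block along Z. On a nonempty piece the coefficient is a value of [s], so a or b bounds
    it; an empty piece has mass 0. *)
Lemma sf_integral_le s Z a b :
  (forall t, Z t -> sf_eval s t <= a) -> (forall t, ~ Z t -> sf_eval s t <= b) ->
  sf_integral mu s <= a * mu Z + b * mu (~` Z).
Proof.
move=> Za Zb; rewrite -(sf_fcharge_sum s Z) -(sf_fcharge_sum s (~` Z)).
rewrite !mulr_sumr -big_split /= ler_sum// => i _.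
rewrite (fcharge_setIC Z) mulrDr lerD//.
  have [->|/set0P[t [it Zt]]] := eqVneq (sf_block i `&` Z) set0.
    by rewrite fcharge_set0 !mulr0.
  by rewrite ler_wpM2r ?fcharge_ge0// -(sf_eval_block it) Za.
have [->|/set0P[t [it Zt]]] := eqVneq (sf_block i `&` ~` Z) set0.
  by rewrite fcharge_set0 !mulr0.
by rewrite ler_wpM2r ?fcharge_ge0// -(sf_eval_block it) Zb.
Qed.

Lemma sf_cst_partition : partition setT (fun _ : 'I_1 => @setT posn) setT.
Proof.
split; [|by move=> i j; rewrite !ord1|by move=> _ _; exists (oddp 0)].
by apply/seteqP; split => // t _; exists ord0.
Qed.

Definition sf_cst (c : R) : simple_fun R := SimpleFun (fun=> c) sf_cst_partition.

Lemma sf_cstE c t : sf_eval (sf_cst c) t = c.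
Proof. by rewrite /sf_eval big_ord1 /= in_setT mulr1. Qed.

Lemma fintegral_le f Z a b c :
  (forall t, c <= f t) ->
  (forall t, Z t -> f t <= a) -> (forall t, ~ Z t -> f t <= b) ->
  fintegral mu f <= a * mu Z + b * mu (~` Z).
Proof.
move=> fc Za Zb; apply: ge_sup.
  (* The lower bound c provides a simple function below f, so the supremum is over a nonempty
     set. *)
  by exists (sf_integral mu (sf_cst c)), (sf_cst c) => // t; rewrite sf_cstE.
move=> _ [s sf <-]; apply: sf_integral_le => t Zt; apply: le_trans (sf t) _.
  exact: Za.
exact: Zb.
Qed.

Lemma le_fintegral f b s :
  (forall t, f t <= b) -> (forall t, sf_eval s t <= f t) ->
  sf_integral mu s <= fintegral mu f.
Proof.
move=> fb sf; apply: ub_le_sup; last by exists s.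
(* The supremum needs an upper bound: [sf_integral_le] with Z the whole space. *)
exists (b * mu setT + b * mu (~` setT)) => _ [s' s'f <-].
by apply: sf_integral_le => t _; apply: le_trans (s'f t) _.
Qed.

Lemma sf_indic_partition (P : set posn) : P !=set0 -> ~` P !=set0 ->
  partition setT (fun i : 'I_2 => if i == ord0 then P else ~` P) setT.
Proof.
move=> P0 CP0; split; last by move=> i _; case: ifP.
  apply/seteqP; split => // t _; have [Pt|Pt] := pselect (P t).
    by exists ord0.
  by exists (lift ord0 ord0).
move=> i j _ _ [t []].
have [->|i0] := eqVneq i ord0; have [->|j0] := eqVneq j ord0 => //= _ _.
by case: i j i0 j0 => -[|[|?]]// ? [[|[|?]]// ?] _ _; exact: val_inj.
Qed.

(** The indicator of Z is a simple function below f. *)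
Lemma fcharge_le_fintegral f b Z : Z !=set0 -> ~` Z !=set0 ->
  (forall t, 0 <= f t <= b) -> (forall t, Z t -> 1 <= f t) ->
  mu Z <= fintegral mu f.
Proof.
move=> Z0 CZ0 f0b Z1.
pose s := SimpleFun (fun i : 'I_2 => if i == ord0 then 1 else 0 : R)
  (sf_indic_partition Z0 CZ0).
have <- : sf_integral mu s = mu Z.
  by rewrite /sf_integral big_ord_recl big_ord1 /= mul1r mul0r addr0.
apply: (@le_fintegral _ b) => t; first by have /andP[] := f0b t.
have [Zt|Zt] := pselect (Z t).
  by rewrite (@sf_eval_block s ord0)// Z1.
by rewrite (@sf_eval_block s (lift ord0 ord0))//=; have /andP[] := f0b t.
Qed.

End Integral.

(** * Expectations over histories of a Markov decision process *)

Section HistoryExpectation.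
Variables (R : realType) (G : mdp R) (sigma : strategy G).
Implicit Type g : forall s : state G, history s -> R.

Fixpoint hlen (s : state G) (h : history s) : nat :=
  if h is hcons _ h' _ _ then (hlen h').+1 else 0.

(** Here t counts the transitions made, so the expectation is at stage t+1. *)
Definition hexpect (t : nat) g : R :=
  \sum_(h <- histories G t) hprob sigma (tagged h) * g (tag h) (tagged h).

(* The conditional expectation of g at the next stage, given the history. *)
Definition hstep g (s : state G) (h : history s) : R :=
  \sum_(a : action s) sigma h a *
    \sum_(s' : state G) transition a s' * g s' (hcons h a s').

Definition stage_reward (s : state G) (h : history s) : R :=
  \sum_(a : action s) sigma h a * reward a.

Lemma hexpect0 g : hexpect 0 g = g (init G) (hinit G).
Proof. by rewrite /hexpect big_seq1 mul1r. Qed.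

(** The tower property: [histories] lists the next histories as one-step extensions. *)
Lemma hexpectS t g : hexpect t.+1 g = hexpect t (hstep g).
Proof.
rewrite /hexpect /= big_allpairs_dep; apply: eq_bigr => -[s h] _ /=.
rewrite big_enum /= -(pair_bigA _ (fun a s' =>
  hprob sigma h * sigma h a * transition a s' * g s' (hcons h a s'))) /=.
rewrite mulr_sumr; apply: eq_bigr => a _.
by rewrite !mulr_sumr; apply: eq_bigr => s' _; rewrite !mulrA.
Qed.

Lemma expected_rewardE (t : posn) :
  expected_reward sigma t = hexpect (val t).-1 stage_reward.
Proof.
rewrite /expected_reward /hexpect; apply: eq_bigr => h _.
by rewrite mulr_sumr; apply: eq_bigr => a _; rewrite mulrA.
Qed.

Lemma hexpectD t g1 g2 :
  hexpect t (fun s h => g1 s h + g2 s h) = hexpect t g1 + hexpect t g2.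
Proof. by rewrite -big_split /=; apply: eq_bigr => h _; rewrite mulrDr. Qed.

Lemma hexpect_cst t c : hexpect t (fun s h => c) = c.
Proof.
elim: t => [|t IHt]; first by rewrite hexpect0.
rewrite hexpectS -[RHS]IHt; congr hexpect.
apply: functional_extensionality_dep => s; apply/funext => h.
rewrite /hstep; under eq_bigr => a _ do rewrite -mulr_suml pmf_sum1 mul1r.
by rewrite -mulr_suml pmf_sum1 mul1r.
Qed.

Lemma hprob_ge0 (s : state G) (h : history s) : 0 <= hprob sigma h.
Proof. by elim: h => //= *; rewrite !mulr_ge0// pmf_ge0. Qed.

Lemma le_hexpect t g1 g2 : (forall s (h : history s), g1 s h <= g2 s h) ->
  hexpect t g1 <= hexpect t g2.
Proof. by move=> g12; apply: ler_sum => h _; rewrite ler_wpM2l ?hprob_ge0. Qed.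

End HistoryExpectation.

(** * Rewards in the even-or-odd process *)

Section EvenOrOdd.
Variable R : realType.
Local Notation G := (even_or_odd R).
Implicit Types (sigma : strategy G) (g : forall s : state G, history s -> R).

Lemma sum_eo_choice (F : eo_choice -> R) : \sum_a F a = F actT + F actB.
Proof.
by rewrite (bigD1 actT)//= (bigD1 actB)//= big1 ?addr0// => -[].
Qed.

Lemma sum_unit (F : unit -> R) : \sum_a F a = F tt.
Proof. by rewrite (bigD1 tt)//= big1 ?addr0// => -[]. Qed.

Lemma eo_transition (s : state G) (a : action s) (F : state G -> R) :
  \sum_s' transition a s' * F s' = F (eo_next a).
Proof.
rewrite (bigD1 (eo_next a))//= eqxx mul1r big1 ?addr0// => s'.
by move=> /negbTE ->; rewrite mul0r.
Qed.

Lemma eo_pmf_unit (p : fdist R unit) : p tt = 1.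
Proof. by rewrite -(pmf_sum1 p) sum_unit. Qed.

Lemma hstep1 sigma g (h : @history R G state1) :
  hstep sigma g h = sigma state1 h actT * g _ (hcons h actT state2)
                  + sigma state1 h actB * g _ (hcons h actB state3).
Proof.
by rewrite /hstep; under eq_bigr do rewrite eo_transition; rewrite sum_eo_choice.
Qed.

Lemma hstep2 sigma g (h : @history R G state2) :
  hstep sigma g h = g _ (hcons (h : @history R G state2) tt state1).
Proof.
rewrite /hstep; under eq_bigr do rewrite eo_transition.
by rewrite sum_unit eo_pmf_unit mul1r.
Qed.

Lemma hstep3 sigma g (h : @history R G state3) :
  hstep sigma g h = g _ (hcons (h : @history R G state3) tt state1).
Proof.
rewrite /hstep; under eq_bigr do rewrite eo_transition.
by rewrite sum_unit eo_pmf_unit mul1r.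
Qed.

(** From state 1 every two transitions lead back to state 1, so after 2k transitions only histories
    ending there have positive probability. The induction unfolds two steps at a time. *)
Lemma eq_hexpect_double sigma k g1 g2 :
  (forall h : @history R G state1, hlen h = k.*2 -> g1 _ h = g2 _ h) ->
  hexpect sigma k.*2 g1 = hexpect sigma k.*2 g2.
Proof.
elim: k g1 g2 => [|k IHk] g1 g2 g12; first by rewrite !hexpect0 g12.
rewrite doubleS !hexpectS; apply: IHk => h hk.
rewrite !hstep1 !hstep2 !hstep3.
by rewrite !g12//= hk.
Qed.

Lemma stage_reward1 sigma (h : @history R G state1) :
  stage_reward sigma h = sigma state1 h actT.
Proof. by rewrite /stage_reward sum_eo_choice /= mulr1 mulr0 addr0. Qed.

Lemma stage_reward2 sigma (h : @history R G state2) : stage_reward sigma h = 0.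
Proof. by rewrite /stage_reward sum_unit /= mulr0. Qed.

Lemma stage_reward3 sigma (h : @history R G state3) : stage_reward sigma h = 1.
Proof. by rewrite /stage_reward sum_unit /= mulr1 eo_pmf_unit. Qed.

Lemma eo_reward_itv sigma t : 0 <= expected_reward sigma t <= 1.
Proof.
have r01 s (h : @history R G s) : 0 <= stage_reward sigma h <= 1.
  case: s h => h; rewrite ?stage_reward1 ?stage_reward2 ?stage_reward3 ?ler01 ?lexx//.
  rewrite pmf_ge0/= -(pmf_sum1 (sigma state1 h)) sum_eo_choice lerDl.
  exact: pmf_ge0.
rewrite expected_rewardE; apply/andP; split.
  rewrite -[X in X <= _](hexpect_cst sigma (val t).-1); apply: le_hexpect => s h.
  by have /andP[] := r01 s h.
rewrite -[X in _ <= X](hexpect_cst sigma (val t).-1); apply: le_hexpect => s h.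
by have /andP[] := r01 s h.
Qed.

(** Given a history at state 1, T pays 1 then 0 and B pays 0 then 1, so the conditional sum is the
    total probability of T and B. *)
Lemma eo_reward_pair sigma k :
  expected_reward sigma (oddp k) + expected_reward sigma (evenp k) = 1.
Proof.
rewrite !expected_rewardE /= hexpectS -hexpectD -[RHS](hexpect_cst sigma k.*2).
apply: eq_hexpect_double => h _.
rewrite hstep1 stage_reward1 stage_reward2 stage_reward3 mulr0 add0r mulr1.
by rewrite -(pmf_sum1 (sigma state1 h)) sum_eo_choice.
Qed.

(** At stage 2k+1 a history has length 2k, so halving recovers the index k of the pair. *)
Definition eo_strategy (A : set nat) : strategy G := fun s =>
  match s with
  | state1 => fun h =>
      fdirac R (if (hlen h)./2 \in A then actB else actT)
  | state2 => fun=> fdirac R tt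
  | state3 => fun=> fdirac R tt
  end.

Lemma eo_strategy_reward_odd (A : set nat) k :
  expected_reward (eo_strategy A) (oddp k) = (k \notin A)%:R.
Proof.
rewrite expected_rewardE /= -[RHS](hexpect_cst (eo_strategy A) k.*2).
apply: eq_hexpect_double => h hk.
by rewrite stage_reward1 /= hk doubleK; case: ifP.
Qed.

Lemma eo_strategy_reward_even (A : set nat) k :
  expected_reward (eo_strategy A) (evenp k) = (k \in A)%:R.
Proof.
have := eo_reward_pair (eo_strategy A) k; rewrite eo_strategy_reward_odd.
by case: (k \in A) => /=; lra.
Qed.

End EvenOrOdd.

(** * The accumulation point, the value, and the absence of optimal strategies *)

Section Accumulation.
Variables (R : realType) (phi : freq_charge R) (mu_star : fcharge R).
Hypothesis mu_star_acc : accumulation_point (mu_mult phi) mu_star.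

(** The approximating indices increase strictly, so they pass n, and c is then within every e > 0 of
    [mu_star W]. *)
Lemma accumulation_eventually_eq (n : nat) (W : set posn) (c : R) :
  (forall m : posn, (n <= val m)%N -> mu_mult phi m W = c) -> mu_star W = c.
Proof.
move=> Wc; apply/eqP; rewrite -subr_eq0 -normr_le0.
apply/ler_addgt0Pr => e e0; rewrite add0r.
have [m [minc mW]] := mu_star_acc (fun _ : 'I_1 => W) e0.
pose p k : posn := exist _ k.+1 isT.
have mk k : (k < val (m (p k)))%N.
  elim: k => [|k IHk]; first exact: valP (m (p 0)).
  by apply: leq_ltn_trans IHk (minc _ _ _).
by have := mW (p n) ord0; rewrite Wc// ltnW.
Qed.

(** For m >= n the multiples of 2^m are multiples of 2^n, so [mu_mult phi m] is concentrated on the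
    latter. *)
Lemma mu_star_mult_set (n : posn) : mu_star (mult_set n) = 1.
Proof.
apply: (@accumulation_eventually_eq (val n)) => m nm.
rewrite /= setIidr ?freq_mult_setM// => x [k xk].
have kP : (0 < val k * 2 ^ (val m - val n))%N.
  by rewrite muln_gt0 expn_gt0 andbT; exact: valP k.
by exists (exist (fun i => (0 < i)%N) _ kP); rewrite xk /= -mulnA -expnD subnK.
Qed.

Lemma mu_star_null (W : set posn) : phi W = 0 -> mu_star W = 0.
Proof.
move=> W0; apply: (@accumulation_eventually_eq 0) => m _ /=.
suff -> : phi (W `&` mult_set m) = 0 by rewrite mulr0.
apply/eqP; rewrite eq_le fcharge_ge0 andbT -W0.
by apply: fcharge_le => x [].
Qed.

Lemma mu_star_diffuse : diffuse mu_star.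
Proof. by move=> n; apply/mu_star_null/freq_diffuse. Qed.

Let mu := mix_fcharge (mu_odd phi) mu_star.

(** The factor 2 of [mu_odd] cancels the weight 1/2. Only the mass of [mu_star] on the odd part and
    of [mu_odd] on the even part is dropped; this lower bound serves both for the value and against
    optimality. *)
Lemma mix_selector A :
  phi (oddp @` A) + 2^-1 * mu_star (evenp @` (~` A)) <= mu (selector A).
Proof.
rewrite /selector fcharge_setU; last first.
  by apply/seteqP; split => // t [[i _ <-] [j _ /esym/oddp_neq_evenp]].
apply: lerD => /=.
  rewrite odd_setE setIidl; last exact: image_subset.
  by rewrite mulKf ?pnatr_eq0// lerDl mulr_ge0 ?fcharge_ge0// invr_ge0.
by rewrite lerDr !mulr_ge0 ?fcharge_ge0// invr_ge0.
Qed.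

Lemma eo_payoff_ge (n : posn) :
  exists sigma : strategy (even_or_odd R), 1 - (2 ^+ val n)^-1 <= payoff mu sigma.
Proof.
pose A := [set k : nat | (2 ^ val n %| k.+1.*2)%N].
have evenA : evenp @` A = mult_set n by rewrite mult_setE.
exists (eo_strategy A); apply: (@le_trans _ _ (mu (selector (~` A)))).
  (* The odd part contributes 1/2 - 2^-n, the even part 1/2. *)
  have := mix_selector (~` A); have := freq_oddpC phi A.
  by rewrite setCK -freq_evenp evenA freq_mult_set mu_star_mult_set; lra.
apply: (@fcharge_le_fintegral _ _ _ 1); [exact: selector_neq0|
  exact: selectorC_neq0|by move=> t; exact: eo_reward_itv|].
move=> _ [[k kA <-]|[k kA <-]].
  by rewrite eo_strategy_reward_odd; move/mem_set: kA; rewrite in_setC => ->.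
by rewrite eo_strategy_reward_even; move: kA; rewrite setCK => /mem_set ->.
Qed.

Lemma eo_payoff_le1 (nu : fcharge R) (sigma : strategy (even_or_odd R)) :
  payoff nu sigma <= 1.
Proof.
have -> : 1 = 1 * nu setT + 1 * nu (~` setT) :> R.
  by rewrite setCT fcharge_set0 fcharge_setT mulr0 mulr1 addr0.
by apply: (@fintegral_le _ _ _ _ _ _ 0) => t; have /andP[] := eo_reward_itv sigma t.
Qed.

Lemma eo_value : value (even_or_odd R) mu = 1.
Proof.
have payoffs_le1 : ubound [set payoff mu sigma | sigma in [set: strategy (even_or_odd R)]] 1.
  by move=> _ [sigma _ <-]; exact: eo_payoff_le1.
apply/eqP; rewrite eq_le; apply/andP; split.
  (* Any strategy will do here: it shows that the set of payoffs is nonempty. *)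
  have [sigma _] := eo_payoff_ge (exist _ 1%N isT).
  by apply: ge_sup => //; exists (payoff mu sigma), sigma.
(* This n makes 2^n exceed 1/e; the successor makes it positive. *)
apply/ler_addgt0Pr => e e0; pose n : posn := exist _ (Num.bound e^-1).+1 isT.
have [sigma sigma_ge] := eo_payoff_ge n.
have : (2 ^+ val n)^-1 < e.
  by rewrite invf_plt ?posrE ?exprn_gt0//; apply/upper_nthrootP/leqnSn.
have : payoff mu sigma <= value (even_or_odd R) mu.
  by apply: ub_le_sup; [exists 1|exists sigma].
lra.
Qed.

Lemma eo_payoff_lt1 (sigma : strategy (even_or_odd R)) : payoff mu sigma < 1.
Proof.
rewrite lt_neqAle eo_payoff_le1 andbT; apply/eqP => payoff1.
pose f := expected_reward sigma.
pose A := [set k : nat | f (oddp k) <= 2^-1].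
have Z_half t : selector A t -> f t <= 2^-1.
  move=> [[k //= kA <-]//|[k /= /negP kA <-]].
  by move: kA; rewrite -ltNge; have := eo_reward_pair sigma k; rewrite /f; lra.
have f01 := eo_reward_itv sigma.
(* The right side is 1 - [mu (selector A)] / 2, so payoff 1 forces the selector to be null. *)
have : payoff mu sigma <= 2^-1 * mu (selector A) + 1 * mu (~` selector A).
  apply: (@fintegral_le _ _ _ _ _ _ 0) => // t; first by have /andP[] := f01 t.
  by move=> _; have /andP[] := f01 t.
rewrite payoff1 fcharge_setC => muZ.
have muA := mix_selector A.
have phiA0 := fcharge_ge0 phi (oddp @` A).
have starA0 := fcharge_ge0 mu_star (evenp @` (~` A)).
have star_evenCA : mu_star (evenp @` (~` A)) = 0 by lra.
have star_evenA : mu_star (evenp @` A) = 0.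
  by apply: mu_star_null; rewrite freq_evenp; lra.
(* For n = 1 the set is that of all even stages, which A and its complement split into two null
   sets. *)
have := mu_star_mult_set (exist _ 1%N isT).
rewrite mult_setE (_ : [set k | _] = A `|` ~` A); last first.
  rewrite setUCr; apply/seteqP; split => // k _ /=.
  by rewrite -muln2; exact: dvdn_mull.
rewrite image_setU fcharge_setU ?star_evenA ?star_evenCA ?addr0; first by lra.
by apply/seteqP; split => // t [[i iA <-] [j jA /evenp_inj ji]]; apply: jA; rewrite ji.
Qed.

End Accumulation.

Theorem theorem3 (R : realType) (phi : freq_charge R) (mu_star : fcharge R)
    (mu_star_acc : accumulation_point (mu_mult phi) mu_star) :
  let mu := mix_fcharge (mu_odd phi) mu_star in
  diffuse mu /\
  ~ (exists sigma : strategy (even_or_odd R), optimal mu sigma).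
Proof.
split.
  move=> n; rewrite -[LHS]/(2^-1 * mu_odd phi [set n] + 2^-1 * mu_star [set n]).
  by rewrite mu_odd_diffuse (mu_star_diffuse mu_star_acc) !mulr0 addr0.
move=> [sigma]; rewrite /optimal eo_value// => payoff1.
by have := eo_payoff_lt1 mu_star_acc sigma; rewrite payoff1 ltxx.
Qed.
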